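(* Let $n \ge 1$ and $d \ge 0$ be integers and let $X = (X_1,\ldots,X_n)$. Suppose that $q \in \mathbb{R}\langle X, X^*\rangle$ and define $S = \sum_{|\alpha|=d} X^{\alpha^*} X^{\alpha}$, the sum being over all multi-indices $\alpha$ of length $d$. Then $p = q^* S q$ has rank at least $(2n)^d$. Here, $(2n)^d$ is the dimension of $\operatorname{span}\{X^\alpha\}_{|\alpha|=d}$.
   Context: $\mathbb{R}\langle X, X^*\rangle$ is the real free $*$-algebra generated by $n$ noncommuting variables $X_1,\ldots,X_n$ and their adjoints $X_1^*,\ldots,X_n^*$; as an algebra it is the free associative unital $\mathbb{R}$-algebra on these $2n$ generators. The involution $*$ is $\mathbb{R}$-linear, reverses products, and satisfies $(X_j)^* = X_j^*$, $(X_j^* )^* = X_j$. For $0<j\le n$ put $X_{j+n} = X_j^*$. A multi-index $\alpha = (\alpha_1,\ldots,\alpha_k)$ is a finite tuple with entries in $\{1,\ldots,2n\}$, of length $|\alpha| = k$; $X^\alpha = X_{\alpha_1}\cdots X_{\alpha_k}$, and $X^\emptyset = 1$. The multi-index $\alpha^*$ is defined by $X^{\alpha^*} = (X^\alpha)^*$. A polynomial $p$ is symmetric if $p^* = p$. A symmetric $p$ is matrix positive if $p(M)$ is positive semidefinite (PSD) for every tuple $M = (M_1,\ldots,M_n)$ of real square matrices of the same size (all sizes allowed), where $p(M)$ is obtained by substituting $M_j$ for $X_j$ and $M_j^T$ for $X_j^*$. The polynomial $q^*Sq$ is matrix positive. For an integer $D \ge 0$ let $V_D$ be the column vector $(X^\alpha)_{|\alpha|\le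 D}$ (monomials in graded lexicographic order) and $V_D^*$ the row vector $(X^{\alpha^*})_{|\alpha|\le D}$. The rank of a matrix positive polynomial $p$ is the minimum of $\operatorname{rank}(M)$ over all real symmetric PSD matrices $M$ such that $V_D^* M V_D = p$ for some $D$.
   Formalization: The polynomial q is assumed nonzero: for q = 0 the polynomial p = 0 is represented by the zero matrix and has rank 0, which is less than (2n)^d, so the claim fails there. *)

(* Defs.v *)
From HB Require Import structures.
From mathcomp Require Import all_boot all_order all_algebra.
From mathcomp Require Import finmap.
From mathcomp Require Import boolp reals.
From mathcomp Require Import monalg.

Set Implicit Arguments.
Unset Strict Implicit.
Unset Printing Implicit Defensive.

Import Order.TTheory GRing.Theory Num.Theory.
Local Open Scope ring_scope.

(* The free *-algebra R<X, X^*> is the monoid algebra over R of the free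
   monoid on 2n letters: with 0-based indices, letter j < n is X_(j+1) and
   letter j + n is its adjoint. *)
Notation letter n := 'I_(n + n).
Notation ncpoly R n := {malg R[{fmonom (letter n)}]}.

Definition linext (R : realType) (K : choiceType) (V : lmodType R)
    (F : K -> V) (p : {malg R[K]}) : V :=
  \sum_(u <- msupp p) p@_u *: F u.

Definition ncmon (R : realType) (n : nat) (a : seq (letter n)) : ncpoly R n :=
  << FMonom a >>.

Definition adjl (n : nat) (i : letter n) : letter n :=
  match split i with inl j => rshift n j | inr j => lshift n j end.

Definition adjw (n : nat) (a : seq (letter n)) : seq (letter n) :=
  rev (map (@adjl n) a).

Definition star (R : realType) (n : nat) : ncpoly R n -> ncpoly R n :=
  linext (fun u : {fmonom (letter n)} => ncmon R (adjw u)).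

Definition mxletter (R : realType) (n m : nat) (M : 'I_n -> 'M[R]_m)
    (i : letter n) : 'M[R]_m :=
  match split i with inl j => M j | inr j => (M j)^T end.

Definition nceval (R : realType) (n m : nat) (M : 'I_n -> 'M[R]_m) :
    ncpoly R n -> 'M[R]_m :=
  linext (fun u : {fmonom (letter n)} => \prod_(i <- u) mxletter M i).

Definition psdmx (R : realType) (m : nat) (A : 'M[R]_m) : Prop :=
  A^T = A /\ forall x : 'cV[R]_m, 0 <= (x^T *m A *m x) 0 0.

Definition matrix_positive (R : realType) (n : nat) (p : ncpoly R n) : Prop :=
  star p = p /\ forall (m : nat) (M : 'I_n -> 'M[R]_m), psdmx (nceval M p).

(* Graded lexicographic order: [enum] lists k-tuples lexicographically. *)
Definition words (n D : nat) : seq (seq (letter n)) :=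
  flatten [seq [seq tval a | a <- enum {: k.-tuple (letter n)}]
             | k <- iota 0 D.+1].

Definition Vcol (R : realType) (n D : nat) : 'cV[ncpoly R n]_(size (words n D)) :=
  \col_i ncmon R (nth [::] (words n D) i).

Definition Vrow (R : realType) (n D : nat) : 'rV[ncpoly R n]_(size (words n D)) :=
  \row_i ncmon R (adjw (nth [::] (words n D) i)).

Definition represents (R : realType) (n D : nat)
    (A : 'M[R]_(size (words n D))) (p : ncpoly R n) : Prop :=
  psdmx A /\
  Vrow R n D *m map_mx (fun c : R => c%:MP : ncpoly R n) A *m Vcol R n D = p%:M.

Definition represented_with_rank (R : realType) (n : nat) (p : ncpoly R n)
    (r : nat) : Prop :=
  exists (D : nat) (A : 'M[R]_(size (words n D))),
    represents A p /\ \rank A = r.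

(* The value 0 of the second branch is never taken: every matrix positive
   polynomial is a sum of squares, hence has a representation (Helton). *)
Definition ncrank (R : realType) (n : nat) (p : ncpoly R n)
    (_ : matrix_positive p) : nat :=
  match pselect (exists r, `[< represented_with_rank p r >]) with
  | left e => ex_minn e
  | right _ => 0
  end.

Definition Ssum (R : realType) (n d : nat) : ncpoly R n :=
  \sum_(a : d.-tuple (letter n)) ncmon R (adjw a) * ncmon R a.

(* [\dim] is not available here: the free algebra is not a [vectType]. *)
Definition in_span (R : realType) (V : lmodType R) (I : finType) (f : I -> V)
    (v : V) : Prop :=
  exists c : I -> R, v = \sum_i c i *: f i.

Definition span_dim (R : realType) (V : lmodType R) (I : finType) (f : I -> V)
    (k : nat) : Prop :=
  exists b : 'I_k -> V,
    (forall c : 'I_k -> R, \sum_i c i *: b i = 0 -> forall i, c i = 0) /\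
    (forall v : V, in_span f v <-> in_span b v).

Section LinExt.
Variables (R : realType) (K : choiceType) (V : lmodType R) (F : K -> V).

Lemma linextEw (d : {fset K}) (p : {malg R[K]}) :
  (msupp p `<=` d)%fset -> linext F p = \sum_(u <- d) p@_u *: F u.
Proof.
move=> le_pd; rewrite /linext (big_fset_incl _ le_pd) //= => u _ /mcoeff_outdom ->.
by rewrite scale0r.
Qed.

Lemma linext_is_linear : linear (linext F).
Proof.
move=> a p q.
pose d := (msupp p `|` msupp q `|` msupp (a *: p + q))%fset.
rewrite !(@linextEw d); last by rewrite /d fsubsetUr.
- rewrite scaler_sumr -big_split /=; apply: eq_bigr => u _.
  by rewrite mcoeffD mcoeffZ scalerDl scalerA.
- by rewrite /d -fsetUA fsetUCA fsubsetUl.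
- by rewrite /d -fsetUA fsubsetUl.
Qed.

HB.instance Definition _ :=
  GRing.isLinear.Build R {malg R[K]} V *:%R (linext F) linext_is_linear.

Lemma linextU (c : R) (u : K) : linext F << c *g u >> = c *: F u.
Proof. by rewrite (linextEw (@msuppU_le _ _ _ _)) big_seq_fset1 mcoeffUU. Qed.
End LinExt.

Section Monomials.
Variables (R : realType) (n : nat).
Implicit Types (a b : seq (letter n)) (p q : ncpoly R n).
Local Notation K := {fmonom (letter n)}.

Lemma linextM (V : lmodType R) (F : K -> V) p q :
  linext F (p * q) =
  \sum_(u <- msupp p) \sum_(v <- msupp q) (p@_u * q@_v) *: F (mmul u v).
Proof.
rewrite malgME linear_sum /=; apply: eq_bigr => u _.
by rewrite linear_sum /=; apply: eq_bigr => v _; rewrite linextU.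
Qed.

Lemma malg_scaleAr (c : R) p q : p * (c *: q) = c *: (p * q).
Proof.
rewrite -!mul_malgC !mulrA; congr (_ * q).
rewrite !malgM_def fgmulUg fgmulgU; apply: eq_bigr => u _.
by rewrite mul1m mulm1 mulrC.
Qed.

Lemma mmulE (u v : K) : mmul u v = FMonom (fmonom_val u ++ fmonom_val v).
Proof. by apply: val_inj; exact: fmM. Qed.

Lemma ncmon_nil : ncmon R [::] = 1 :> ncpoly R n.
Proof.
rewrite -[RHS](mpolyC1E _ R) /ncmon; congr << _ >>.
by apply: val_inj; exact: esym fm1.
Qed.

Lemma ncmon_cat a b : ncmon R (a ++ b) = ncmon R a * ncmon R b.
Proof. by rewrite malgM_def fgmulUU mulr1 mmulE. Qed.

Lemma adjlK : involutive (@adjl n).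
Proof.
move=> i; rewrite /adjl; case: (split_ordP i) => j ->.
  by case: (split_ordP (rshift n j)) => k /eqP;
    rewrite ?eq_rlshift ?eq_rshift // => /eqP ->.
by case: (split_ordP (lshift n j)) => k /eqP;
  rewrite ?eq_lrshift ?eq_lshift // => /eqP ->.
Qed.

Lemma adjwK : involutive (@adjw n).
Proof. by move=> a; rewrite /adjw map_rev revK (mapK adjlK). Qed.

Lemma adjw_cat a b : adjw (a ++ b) = adjw b ++ adjw a.
Proof. by rewrite /adjw map_cat rev_cat. Qed.

HB.instance Definition _ := GRing.Linear.copy (@star R n)
  (linext (fun u : K => ncmon R (adjw u))).

Lemma star_mon a : star (ncmon R a) = ncmon R (adjw a).
Proof. by rewrite /star linextU scale1r. Qed.

Lemma starK : involutive (@star R n).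
Proof.
move=> p; rewrite {2}/star /linext linear_sum /= [RHS]monalgE.
apply: eq_bigr => u _; rewrite linearZ /= star_mon adjwK /ncmon.
by apply/malgP => v; rewrite mcoeffZ !mcoeffU fmK mulr_natr.
Qed.

Lemma starM p q : star (p * q) = star q * star p.
Proof.
rewrite /star linextM /linext mulr_suml exchange_big; apply: eq_bigr => v _.
rewrite mulr_sumr; apply: eq_bigr => u _.
by rewrite mmulE adjw_cat ncmon_cat malg_scaleAr -scalerAl scalerA.
Qed.

Lemma star_Ssum d : star (Ssum R n d) = Ssum R n d.
Proof.
rewrite /Ssum linear_sum /=; apply: eq_bigr => a _.
by rewrite starM !star_mon adjwK.
Qed.

Section Eval.
Variables (m : nat) (M : 'I_n -> 'M[R]_m).

HB.instance Definition _ := GRing.Linear.copy (nceval M)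
  (linext (fun u : K => \prod_(i <- u) mxletter M i)).

Lemma nceval_mon a : nceval M (ncmon R a) = \prod_(i <- a) mxletter M i.
Proof. by rewrite /nceval linextU scale1r. Qed.

Lemma ncevalM p q : nceval M (p * q) = nceval M p *m nceval M q.
Proof.
rewrite /nceval linextM /linext mulmx_suml; apply: eq_bigr => u _.
rewrite mulmx_sumr; apply: eq_bigr => v _.
by rewrite mmulE big_cat -scalemxAl -scalemxAr scalerA.
Qed.

Lemma mxletter_adj i : mxletter M (adjl i) = (mxletter M i)^T.
Proof.
rewrite /mxletter /adjl; case: (split_ordP i) => j _ /=.
  by case: (split_ordP (rshift n j)) => k /eqP;
    rewrite ?eq_rlshift ?eq_rshift // => /eqP ->.
by case: (split_ordP (lshift n j)) => k /eqP;
  rewrite ?eq_lrshift ?eq_lshift // => /eqP ->; rewrite trmxK.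
Qed.

Lemma prod_mxletter_adj a :
  \prod_(i <- adjw a) mxletter M i = (\prod_(i <- a) mxletter M i)^T.
Proof.
elim: a => [|i a IHa]; first by rewrite !big_nil trmx1.
by rewrite /adjw /= rev_cons -cats1 big_cat big_seq1 big_cons IHa mxletter_adj trmx_mul.
Qed.

Lemma nceval_star p : nceval M (star p) = (nceval M p)^T.
Proof.
rewrite /star /linext linear_sum /= {2}/nceval /linext linear_sum /=.
apply: eq_bigr => u _.
by rewrite !linearZ /= nceval_mon prod_mxletter_adj.
Qed.
End Eval.

Lemma matrix_positive_sandwich d q : matrix_positive (star q * Ssum R n d * q).
Proof.
have sym : star (star q * Ssum R n d * q) = star q * Ssum R n d * q.
  by rewrite !starM starK star_Ssum mulrA.
split=> // m M; split; first by rewrite -nceval_star sym.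
move=> x; rewrite !ncevalM nceval_star.
move: (nceval M q) => Q.
have -> : nceval M (Ssum R n d) = \sum_(a : d.-tuple (letter n))
    (\prod_(i <- a) mxletter M i)^T *m \prod_(i <- a) mxletter M i.
  rewrite /Ssum linear_sum /=; apply: eq_bigr => a _.
  by rewrite ncevalM !nceval_mon prod_mxletter_adj.
rewrite mulmx_sumr mulmx_suml mulmx_sumr mulmx_suml summxE.
apply: sumr_ge0 => a _; move: (\prod_(i <- a) _) => A.
have -> : x^T *m (Q^T *m (A^T *m A) *m Q) *m x
        = (A *m Q *m x)^T *m (A *m Q *m x) by rewrite !trmx_mul !mulmxA.
by rewrite mxE; apply: sumr_ge0 => i _; rewrite mxE -expr2 sqr_ge0.
Qed.
End Monomials.

(* Main.v *)
(* Let A be a PSD Gram matrix of p = q^* S q, and let e be the maximal word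
   length in q.  The entry of A at (u, u) with u of maximal length among the
   nonzero diagonal entries is the coefficient of u^* u in p, and p has degree
   at most 2(d + e); hence A is supported on words of length at most d + e.
   On words of length exactly d + e its entries are then coefficients of p.
   Fixing a word u of length e with q_u <> 0, the block of A indexed by the
   words a u, |a| = d, is q_u^2 times the identity of size (2n)^d. *)
Require Import Defs.
From mathcomp Require Import all_boot all_order all_algebra.
From mathcomp Require Import finmap.
From mathcomp Require Import boolp reals.
From mathcomp Require Import monalg.

Set Implicit Arguments.
Unset Strict Implicit.
Unset Printing Implicit Defensive.

Import Order.TTheory GRing.Theory Num.Theory.
Local Open Scope ring_scope.

Lemma mem_words n D (u : seq (letter n)) : (u \in words n D) = (size u <= D)%N.
Proof.
apply/flatten_mapP/idP => [[k]|leuD].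
  by rewrite mem_iota add0n => ltkD /mapP[a _ ->]; rewrite size_tuple -ltnS.
exists (size u); first by rewrite mem_iota add0n ltnS.
by apply/mapP; exists (in_tuple u); rewrite ?mem_enum.
Qed.

Lemma words_uniq n D : uniq (words n D).
Proof.
apply: allpairs_uniq_dep => [|k _|].
- exact: iota_uniq.
- exact: enum_uniq.
move=> [k a] [l b] _ _ /= eqab.
have eqkl : k = l by rewrite -(size_tuple a) eqab size_tuple.
by case: l / eqkl b eqab => b /val_inj ->.
Qed.

Lemma nth_words_inj n D :
  injective (fun i : 'I_(size (words n D)) => nth [::] (words n D) i).
Proof.
by move=> i j /eqP; rewrite nth_uniq ?words_uniq // => /eqP/val_inj.
Qed.

Section PsdMatrix.
Variables (R : realType) (m : nat).
Implicit Types A : 'M[R]_m.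

Lemma psdmx_diag0 A i j : psdmx A -> A i i = 0 -> A i j = 0.
Proof.
case=> symA psdA Aii; apply/eqP/negPn/negP => Aij.
have Aji : A j i = A i j by rewrite -{1}symA mxE.
pose t := - (A j j + 1) / (A i j *+ 2).
have := psdA (t *: delta_mx i 0 + delta_mx j 0).
rewrite [(_ + _)^T]linearD /= [(_ *: _)^T]linearZ /= !trmx_delta.
rewrite !(mulmxDl, mulmxDr) -!(scalemxAl, scalemxAr).
rewrite -!rowE -!colE !mxE Aii Aji !mulr0 add0r addrA -mulr2n -mulrnAr.
by rewrite divfK ?mulrn_eq0 // opprD addrAC addNr add0r ler0N1.
Qed.

Lemma psdmx_gram k (B : 'M[R]_(k, m)) : psdmx (B^T *m B).
Proof.
split=> [|x]; first by rewrite trmx_mul trmxK.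
rewrite mulmxA -trmx_mul -mulmxA mxE.
by apply: sumr_ge0 => i _; rewrite mxE -expr2 sqr_ge0.
Qed.
End PsdMatrix.

Section Coefficients.
Variables (R : realType) (n : nat).
Implicit Types (u v w : seq (letter n)) (p q : ncpoly R n).

Lemma size_adjw u : size (adjw u) = size u.
Proof. by rewrite size_rev size_map. Qed.

Lemma mcoeff_ncmon u v : (ncmon R u)@_(FMonom v) = (u == v)%:R.
Proof. by rewrite mcoeffU. Qed.

Lemma ncpolyE q : q = \sum_(x <- msupp q) q@_x *: ncmon R x.
Proof.
rewrite {1}[q]monalgE; apply: eq_bigr => x _.
by apply/malgP => v; rewrite mcoeffZ !mcoeffU fmK mulr_natr.
Qed.

Lemma mcoeff_ncmonM a q w :
  (ncmon R a * q)@_(FMonom w) =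
    (take (size a) w == a)%:R * q@_(FMonom (drop (size a) w)).
Proof.
rewrite {1}[q]ncpolyE mulr_sumr raddf_sum [q in RHS]ncpolyE raddf_sum mulr_sumr.
apply: eq_bigr => x _ /=.
rewrite malg_scaleAr -ncmon_cat !mcoeffZ !mcoeff_ncmon mulrCA -natrM mulnb.
congr (_ * _%:R); congr nat_of_bool; apply/eqP/andP => [<-|[/eqP ta /eqP ->]].
  by rewrite take_size_cat // drop_size_cat.
by rewrite -{1}ta cat_take_drop.
Qed.

Lemma exists_top_word q : q != 0 ->
  exists2 u, q@_(FMonom u) != 0 &
    forall v, q@_(FMonom v) != 0 -> (size v <= size u)%N.
Proof.
rewrite -msupp_eq0 => /fset0Pn[x xq].
case: (@arg_maxnP (msupp q) [` xq]%fset predT (fun y => size (val y))) => // y _ ymax.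
exists (val y) => [|v]; first by rewrite fmK mcoeff_neq0 fsvalP.
by rewrite mcoeff_neq0 => vq; exact: (ymax [` vq]%fset).
Qed.

Definition gram_poly N (w : 'I_N -> seq (letter n)) (A : 'M[R]_N) : ncpoly R n :=
  \sum_i \sum_j A i j *: ncmon R (adjw (w i) ++ w j).

Lemma mcoeff_gram_poly N (w : 'I_N -> seq (letter n)) (A : 'M[R]_N) x :
  (gram_poly w A)@_(FMonom x) =
    \sum_i \sum_j A i j * (adjw (w i) ++ w j == x)%:R.
Proof.
rewrite raddf_sum; apply: eq_bigr => i _; rewrite raddf_sum; apply: eq_bigr => j _.
by rewrite /= mcoeffZ mcoeff_ncmon.
Qed.

(* A word of length 2k splits in only one way into two words of length at most
   k, so only one Gram entry contributes to the coefficient. *)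
Lemma mcoeff_gram_poly_top N (w : 'I_N -> seq (letter n)) (A : 'M[R]_N) k u v :
    (forall i j, A i j != 0 -> ((size (w i) <= k) && (size (w j) <= k))%N) ->
    size u = k -> size v = k ->
  (gram_poly w A)@_(FMonom (adjw u ++ v)) =
    \sum_i \sum_j A i j * ((w i == u) && (w j == v))%:R.
Proof.
move=> Ak su sv; rewrite mcoeff_gram_poly.
apply: eq_bigr => i _; apply: eq_bigr => j _.
have [->|/Ak/andP[lei lej]] := eqVneq (A i j) 0; first by rewrite !mul0r.
congr (_ * _%:R); congr nat_of_bool.
apply/eqP/andP => [e|[/eqP-> /eqP->] //].
have szi : size (w i) = k.
  have := congr1 size e; rewrite !size_cat !size_adjw su sv => e'.
  by apply/eqP; rewrite eqn_leq lei -(leq_add2r k) -e' leq_add2l.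
move/eqP: e; rewrite eqseq_cat ?size_adjw ?szi // => /andP[e ->]; split=> //.
by rewrite (can_eq (@adjwK n)) in e.
Qed.

Lemma gram_poly_degree N (w : 'I_N -> seq (letter n)) (A : 'M[R]_N) e :
    injective w -> psdmx A ->
    (forall x, (e + e < size x)%N -> (gram_poly w A)@_(FMonom x) = 0) ->
  forall i j, A i j != 0 -> ((size (w i) <= e) && (size (w j) <= e))%N.
Proof.
move=> injw psdA pe.
have symA i j : A i j = A j i by case: psdA => symA _; rewrite -{1}symA mxE.
have offdiag i j : A i j != 0 -> (A i i != 0) && (A j j != 0).
  move=> Aij; apply/andP; split; apply: contra_neq Aij => A0.
    exact: psdmx_diag0 A0.
  by rewrite symA; exact: psdmx_diag0 A0.
suff diag i : A i i != 0 -> (size (w i) <= e)%N.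
  by move=> i j /offdiag/andP[/diag-> /diag->].
move=> Ai; rewrite leqNgt; apply/negP => lti.
case: (@arg_maxnP _ i (fun j => A j j != 0) (fun j => size (w j)) Ai) => k Ak kmax.
have ltk : (e < size (w k))%N by exact: leq_trans lti (kmax i Ai).
have := pe (adjw (w k) ++ w k).
rewrite size_cat size_adjw -addnS => /(_ (leq_add (ltnW ltk) ltk)).
rewrite (@mcoeff_gram_poly_top _ _ _ (size (w k))) //; last first.
  by move=> a b /offdiag/andP[/kmax lea /kmax leb]; apply/andP; split.
rewrite (bigD1 k) //= [X in _ + X]big1 => [|a ak].
  rewrite (bigD1 k) //= big1 => [|b bk].
    by rewrite eqxx mulr1 !addr0; move/eqP; rewrite (negPf Ak).
  by rewrite (inj_eq injw b) (negPf bk) andbF mulr0.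
by rewrite big1 // => b _; rewrite (inj_eq injw) (negPf ak) mulr0.
Qed.

Lemma gram_poly_rank N (w : 'I_N -> seq (letter n)) (A : 'M[R]_N) e m
    (u : 'I_m -> seq (letter n)) (c : R) :
    injective w -> psdmx A ->
    (forall x, (e + e < size x)%N -> (gram_poly w A)@_(FMonom x) = 0) ->
    (forall a, size (u a) = e) -> c != 0 ->
    (forall a b,
       (gram_poly w A)@_(FMonom (adjw (u a) ++ u b)) = c *+ (a == b)) ->
  (m <= \rank A)%N.
Proof.
move=> injw psdA pe su c0 pu.
pose P := \matrix_(a < m, i < N) ((w i == u a)%:R : R).
have PAP : P *m A *m P^T = c%:M.
  apply/matrixP => a b; rewrite mxE [RHS]mxE -pu.
  rewrite (mcoeff_gram_poly_top (gram_poly_degree injw psdA pe)) // exchange_big.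
  apply: eq_bigr => j _; rewrite mxE mulr_suml; apply: eq_bigr => i _.
  by rewrite !mxE -mulnb natrM mulrA [_ * A i j]mulrC.
have /mxrank_unit <- : (c%:M : 'M[R]_m) \in unitmx.
  by rewrite unitmxE det_scalar unitrX // unitfE.
by rewrite -PAP (leq_trans (mxrankM_maxl _ _)) ?mxrankM_maxr.
Qed.

Lemma VcolMVrowE D (A : 'M[R]_(size (words n D))) :
  Vrow R n D *m map_mx (fun c : R => c%:MP : ncpoly R n) A *m Vcol R n D =
    (gram_poly (fun i => nth [::] (words n D) i) A)%:M.
Proof.
apply/matrixP => r s; rewrite !ord1 !mxE mulr1n /gram_poly exchange_big.
apply: eq_bigr => j _; rewrite mxE mulr_suml; apply: eq_bigr => i _.
rewrite !mxE ncmon_cat -[_%:MP]mulr1 mul_malgC malg_scaleAr mulr1.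
by rewrite scalerAl.
Qed.

Lemma representsE D (A : 'M[R]_(size (words n D))) p :
  represents A p <->
    psdmx A /\ p = gram_poly (fun i => nth [::] (words n D) i) A.
Proof.
rewrite /represents VcolMVrowE; split=> -[psdA Ap]; split=> //; last by rewrite Ap.
by move/matrixP/(_ 0 0): Ap; rewrite !mxE !mulr1n => ->.
Qed.

Lemma ncpoly_wordsE D q :
    (forall v, q@_(FMonom v) != 0 -> (size v <= D)%N) ->
  q = \sum_(i < size (words n D))
        q@_(FMonom (nth [::] (words n D) i)) *: ncmon R (nth [::] (words n D) i).
Proof.
move=> qD; apply/malgP => -[v]; rewrite raddf_sum /=.
under eq_bigr do rewrite mcoeffZ mcoeff_ncmon.
have [vD|vD] := boolP (v \in words n D).
  move: (vD); rewrite -index_mem => ltv.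
  rewrite (bigD1 (Ordinal ltv)) //= nth_index // eqxx mulr1 big1 ?addr0 // => i iv.
  have /negPf := iv; rewrite -val_eqE /= => iv'.
  by rewrite -[v in _ == v](nth_index [::] vD) nth_uniq ?words_uniq // iv' mulr0.
rewrite big1 => [|i _].
  by apply/eqP; apply: contraNT vD => /qD; rewrite mem_words.
by case: eqP vD => [<-|]; rewrite ?mem_nth ?mulr0.
Qed.

Section Sandwich.
Variables (d e : nat) (q : ncpoly R n).
Hypothesis q_deg : forall v, q@_(FMonom v) != 0 -> (size v <= e)%N.
Local Notation T := (d.-tuple (letter n)).
Local Notation W := (fun i : 'I_(size (words n (d + e))) =>
  nth [::] (words n (d + e)) i).

Definition sandwich_factor : 'M[R]_(#|{: T}|, size (words n (d + e))) :=
  \matrix_(c < #|{: T}|, i < size (words n (d + e))) (ncmon R (enum_val c : T) * q)@_(FMonom (W i)).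

Lemma sandwichE :
  star q * Ssum R n d * q = gram_poly W (sandwich_factor^T *m sandwich_factor).
Proof.
transitivity (\sum_(c < #|{: T}|)
    star (ncmon R (enum_val c : T) * q) * (ncmon R (enum_val c : T) * q)).
  rewrite /Ssum mulr_sumr mulr_suml (reindex (@enum_val T predT)) /=; last first.
    by apply: onW_bij; exact: enum_val_bij.
  by apply: eq_bigr => c _; rewrite starM star_mon !mulrA.
rewrite /gram_poly.
under [RHS]eq_bigr => i _.
  under eq_bigr => j _ do rewrite mxE scaler_suml.
  rewrite exchange_big /=; over.
rewrite exchange_big /=; apply: eq_bigr => c _.
have {1 2}-> : ncmon R (enum_val c : T) * q =
    \sum_i sandwich_factor c i *: ncmon R (W i).
  under eq_bigr => i _ do rewrite mxE.
  apply: ncpoly_wordsE => v; rewrite mcoeff_ncmonM size_tuple.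
  move=> nz; have : q@_(FMonom (drop d v)) != 0.
    by apply: contraNneq nz => ->; rewrite mulr0.
  by move/q_deg; rewrite size_drop leq_subLR.
rewrite linear_sum /= mulr_suml; apply: eq_bigr => i _.
rewrite mulr_sumr; apply: eq_bigr => j _.
by rewrite linearZ /= star_mon malg_scaleAr -scalerAl scalerA ncmon_cat [_^T _ _]mxE mulrC.
Qed.

Lemma sandwich_represented :
  exists r, represented_with_rank (star q * Ssum R n d * q) r.
Proof.
exists (\rank (sandwich_factor^T *m sandwich_factor)).
exists (d + e)%N, (sandwich_factor^T *m sandwich_factor); split=> //.
by apply/representsE; rewrite -sandwichE; split; first exact: psdmx_gram.
Qed.

Lemma mcoeff_sandwich_high x : (d + e + (d + e) < size x)%N ->
  (star q * Ssum R n d * q)@_(FMonom x) = 0.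
Proof.
move=> ltx; rewrite sandwichE mcoeff_gram_poly big1 // => i _; rewrite big1 // => j _.
case: eqP => [xE|]; last by rewrite mulr0.
move: ltx; rewrite -xE size_cat size_adjw ltnNge leq_add //.
all: by rewrite -mem_words mem_nth.
Qed.

Lemma mcoeff_sandwich_top u (a b : T) : size u = e ->
  (star q * Ssum R n d * q)@_(FMonom (adjw (a ++ u) ++ (b ++ u))) =
    (q@_(FMonom u) ^+ 2) *+ (a == b).
Proof.
move=> su.
have W_onto (c : T) : exists i, W i = c ++ u.
  have cW : c ++ u \in words n (d + e) by rewrite mem_words size_cat size_tuple su.
  move: (cW); rewrite -index_mem => ltW.
  by exists (Ordinal ltW); rewrite /= nth_index.
have injW := @nth_words_inj n (d + e).
have [[i Wi] [j Wj]] := (W_onto a, W_onto b).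
rewrite sandwichE (@mcoeff_gram_poly_top _ _ _ (d + e)); first last.
- by rewrite size_cat size_tuple su.
- by rewrite size_cat size_tuple su.
- by move=> k l _; rewrite -!mem_words !mem_nth.
rewrite (bigD1 i) //= [X in _ + X]big1 => [|k ki]; last first.
  by rewrite big1 // => l _; rewrite -Wi (inj_eq injW) (negPf ki) mulr0.
rewrite (bigD1 j) //= [X in _ + X + _]big1 => [|l lj]; last first.
  by rewrite -Wj (inj_eq injW) (negPf lj) andbF mulr0.
have factorE (c f : T) k : W k = f ++ u ->
    (ncmon R c * q)@_(FMonom (W k)) = (f == c)%:R * q@_(FMonom u).
  move=> ->; rewrite mcoeff_ncmonM size_tuple take_size_cat ?size_tuple //.
  by rewrite drop_size_cat ?size_tuple // val_eqE.
rewrite Wi Wj !eqxx mulr1 !addr0 mxE.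
rewrite (bigD1 (enum_rank a)) //= big1 => [|c ca].
  rewrite !mxE enum_rankK (factorE _ _ _ Wi) (factorE _ _ _ Wj) eqxx mul1r addr0.
  by rewrite mulrCA -expr2 mulr_natl eq_sym.
rewrite !mxE (factorE _ _ _ Wi) -(inj_eq enum_rank_inj) enum_valK eq_sym.
by rewrite (negPf ca) !mul0r.
Qed.
End Sandwich.
End Coefficients.

Lemma span_dim_ncmon (R : realType) (n d : nat) :
  span_dim (fun a : d.-tuple (letter n) => ncmon R a) #|{: d.-tuple (letter n)}|.
Proof.
exists (fun i => ncmon R (enum_val i : d.-tuple (letter n))); split=> [c c0 i|v].
  have := congr1 (mcoeff (FMonom (tval (enum_val i)))) c0.
  rewrite raddf_sum mcoeff0 /= (bigD1 i) //= mcoeffZ mcoeff_ncmon eqxx mulr1.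
  rewrite big1 ?addr0 // => j ji; rewrite mcoeffZ mcoeff_ncmon val_eqE.
  by rewrite (inj_eq enum_val_inj) (negPf ji) mulr0.
split=> -[c ->].
  exists (c \o enum_val).
  rewrite (reindex (@enum_val _ predT)) //=.
  by apply: onW_bij; exact: enum_val_bij.
exists (c \o enum_rank).
rewrite (reindex (@enum_rank _)) /=; last by apply: onW_bij; exact: enum_rank_bij.
by apply: eq_bigr => a _; rewrite enum_rankK.
Qed.

Theorem theorem3p1 (R : realType) (n d : nat) (n_ge1 : (1 <= n)%N)
    (q : ncpoly R n) (q_neq0 : q != 0) :
  ((2 * n) ^ d <= @ncrank R n (star q * Ssum R n d * q)
                    (matrix_positive_sandwich d q))%N /\
  span_dim (fun a : d.-tuple (letter n) => ncmon R a) ((2 * n) ^ d)%N.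
Proof.
have <- : #|{: d.-tuple (letter n)}| = ((2 * n) ^ d)%N.
  by rewrite card_tuple card_ord mul2n addnn.
split; last exact: span_dim_ncmon.
have [u qu q_deg] := exists_top_word q_neq0.
rewrite /ncrank; case: pselect => [ex_r|no_r]; last first.
  case: no_r; have [r rep_r] := sandwich_represented d q_deg.
  by exists r; apply/asboolP.
case: ex_minnP => r /asboolP[D [A [/representsE[psdA pA] <-]]] _.
apply: (@gram_poly_rank _ _ _ (fun i => nth [::] (words n D) i) A (d + size u) _
  (fun c => (enum_val c : d.-tuple (letter n)) ++ u) (q@_(FMonom u) ^+ 2)) => //.
- exact: nth_words_inj.
- by move=> x; rewrite -pA; exact: mcoeff_sandwich_high.
- by move=> c; rewrite size_cat size_tuple.
- by rewrite expf_neq0.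
- by move=> a b; rewrite -pA (mcoeff_sandwich_top q_deg) // (inj_eq enum_val_inj).
Qed.
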